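(* For every integer $n \geq 0$, \[ E_n^{*}(x) = \sum_{l=0}^n S_2(n,l)\, c_l(x). \]
   Context: All generating functions are formal power series in $t$. The type 2 Euler polynomials $E_n^{*}(x)$ are defined by $\frac{2}{e^t+e^{-t}}e^{xt} = \sum_{n\ge 0} E_n^{*}(x)\frac{t^n}{n!}$. The type 2 Changhee polynomials $c_n(x)$ are defined by $\frac{2}{(1+t)+(1+t)^{-1}}(1+t)^x = \sum_{n\ge0} c_n(x)\frac{t^n}{n!}$. The Stirling numbers of the second kind $S_2(n,l)$ are defined by $\frac{1}{l!}(e^t-1)^l = \sum_{n\ge l} S_2(n,l)\frac{t^n}{n!}$. *)

(* Defs.v *)
From HB Require Import structures.
From mathcomp Require Import all_boot all_order all_algebra.
From mathcomp Require Import boolp.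

Set Implicit Arguments.
Unset Strict Implicit.
Unset Printing Implicit Defensive.

Import GRing.Theory.
Local Open Scope ring_scope.

(* Formal power series in t over R, as coefficient sequences: [f n] is the    *)
(* coefficient of t^n.  The eqType/choiceType structures are classical.       *)
Record fps (R : Type) := FPS { fps_coef :> nat -> R }.

HB.instance Definition _ (R : Type) := gen_eqMixin (fps R).
HB.instance Definition _ (R : Type) := gen_choiceMixin (fps R).

Lemma fpsP (R : Type) (f g : fps R) : (forall n, f n = g n) <-> f = g.
Proof.
by split=> [|->//]; case: f g => [f] [g] /= fg; congr FPS; apply/funext.
Qed.

Section FpsZmodule.
Variable R : zmodType.
Implicit Types f g h : fps R.

Definition fps_zero : fps R := FPS (fun=> 0).
Definition fps_opp f : fps R := FPS (fun n => - f n).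
Definition fps_add f g : fps R := FPS (fun n => f n + g n).

Fact fps_addA : associative fps_add.
Proof. by move=> f g h; apply/fpsP => n /=; rewrite addrA. Qed.
Fact fps_addC : commutative fps_add.
Proof. by move=> f g; apply/fpsP => n /=; rewrite addrC. Qed.
Fact fps_add0 : left_id fps_zero fps_add.
Proof. by move=> f; apply/fpsP => n /=; rewrite add0r. Qed.
Fact fps_addN : left_inverse fps_zero fps_opp fps_add.
Proof. by move=> f; apply/fpsP => n /=; rewrite addNr. Qed.

HB.instance Definition _ :=
  GRing.isZmodule.Build (fps R) fps_addA fps_addC fps_add0 fps_addN.

Lemma coef_fps0 n : (0 : fps R) n = 0. Proof. by []. Qed.
Lemma coef_fpsN f n : (- f) n = - f n. Proof. by []. Qed.
Lemma coef_fpsD f g n : (f + g) n = f n + g n. Proof. by []. Qed.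
Lemma coef_fpsMn f k n : (f *+ k) n = f n *+ k.
Proof. by elim: k => // k IHk; rewrite !mulrS coef_fpsD IHk. Qed.

End FpsZmodule.

Section FpsRing.
Variable R : comNzRingType.
Implicit Types f g h : fps R.

Definition fps_one : fps R := FPS (fun n => (n == 0)%:R).
Definition fps_mul f g : fps R :=
  FPS (fun n => \sum_(i < n.+1) f i * g (n - i)%N).

Fact fps_mul_rev f g n : fps_mul f g n = \sum_(i < n.+1) f (n - i)%N * g i.
Proof.
rewrite /= (reindex_inj rev_ord_inj) /=.
by apply: eq_bigr => j _; rewrite (sub_ordK j).
Qed.

Fact fps_mulC : commutative fps_mul.
Proof.
move=> f g; apply/fpsP => n; rewrite fps_mul_rev.
by apply: eq_bigr => j _; rewrite mulrC.
Qed.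

Fact fps_mulA : associative fps_mul.
Proof.
move=> f g h; apply/fpsP => n; rewrite [RHS]fps_mul_rev [LHS]/=.
pose coef3 j k := f j * (g (n - j - k)%N * h k).
transitivity (\sum_(j < n.+1) \sum_(k < n.+1 | (k <= n - j)%N) coef3 j k).
  apply: eq_bigr => /= j _; rewrite -[X in _ * X]/(fps_mul g h _) fps_mul_rev.
  by rewrite big_distrr /= (big_ord_narrow_leq (leq_subr _ _)).
rewrite (exchange_big_dep predT) //=; apply: eq_bigr => k _.
transitivity (\sum_(j < n.+1 | (j <= n - k)%N) coef3 j k).
  apply: eq_bigl => j; rewrite -ltnS -(ltnS j) -!subSn ?leq_ord //.
  by rewrite -subn_gt0 -(subn_gt0 j) -!subnDA addnC.
rewrite (big_ord_narrow_leq (leq_subr _ _)) big_distrl /=.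
by apply: eq_bigr => j _; rewrite /coef3 -!subnDA addnC mulrA.
Qed.

Fact fps_mul1 : left_id fps_one fps_mul.
Proof.
move=> f; apply/fpsP => n /=; rewrite big_ord_recl /= mul1r subn0.
by rewrite big1 ?addr0 // => i _; rewrite mul0r.
Qed.

Fact fps_mulDl : left_distributive fps_mul +%R.
Proof.
move=> f g h; apply/fpsP => n /=; rewrite -big_split /=.
by apply: eq_bigr => i _; rewrite mulrDl.
Qed.

Fact fps_one_neq0 : fps_one != 0.
Proof. by apply/eqP => /fpsP/(_ 0%N)/eqP; rewrite /= oner_eq0. Qed.

HB.instance Definition _ := GRing.Zmodule_isComNzRing.Build (fps R)
  fps_mulA fps_mulC fps_mul1 fps_mulDl fps_one_neq0.

Lemma coef_fps1 n : (1 : fps R) n = (n == 0)%:R. Proof. by []. Qed.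
Lemma coef_fpsM f g n : (f * g) n = \sum_(i < n.+1) f i * g (n - i)%N.
Proof. by []. Qed.
Lemma coef_fps_nat k n : (k%:R : fps R) n = (k * (n == 0))%:R.
Proof. by rewrite coef_fpsMn coef_fps1 -mulrnA mulnC. Qed.

Definition fpsX : fps R := FPS (fun n => (n == 1)%:R).

End FpsRing.

Section FpsUnitRing.
Variable R : comUnitRingType.
Implicit Types f g h : fps R.

(* A series is invertible iff its constant coefficient is.  The inverse g of  *)
(* f is computed by solving f * g = 1 for g 0, g 1, ... successively; as      *)
(* required of unitRingTypes, f^-1 = f when f is not invertible.              *)
Definition fps_unit : {pred fps R} := fun f => f 0%N \is a GRing.unit.

Fixpoint fps_inv_seq f n : seq R :=
  if n is m.+1 then
    let s := fps_inv_seq f m in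
    rcons s ((f 0%N)^-1 * ((m == 0)%:R - \sum_(i < m) f (m - i)%N * s`_i))
  else [::].

Definition fps_inv f : fps R :=
  if f \in fps_unit then FPS (fun n => (fps_inv_seq f n.+1)`_n) else f.

Lemma size_fps_inv_seq f n : size (fps_inv_seq f n) = n.
Proof. by elim: n => //= n IHn; rewrite size_rcons IHn. Qed.

Lemma nth_fps_inv_seq f n i :
  (i < n)%N -> (fps_inv_seq f n)`_i = (fps_inv_seq f i.+1)`_i.
Proof.
elim: n => // n IHn; rewrite ltnS leq_eqVlt => /predU1P[-> //|lt_in].
by rewrite [LHS]/= nth_rcons size_fps_inv_seq lt_in IHn.
Qed.

Fact fps_mulVx : {in fps_unit, left_inverse 1 fps_inv *%R}.
Proof.
move=> f uf; apply/fpsP => n; rewrite /fps_inv uf mulrC.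
rewrite [LHS]fps_mul_rev coef_fps1 big_ord_recr subnn /= nth_rcons.
rewrite size_fps_inv_seq ltnn eqxx mulrA mulrV // mul1r addrC.
rewrite -addrA addrC -[RHS]add0r; congr (_ + _); apply/eqP.
rewrite addrC subr_eq0; apply/eqP.
apply: eq_bigr => i _; congr (_ * _).
by rewrite (nth_fps_inv_seq _ (ltn_ord i)).
Qed.

Fact fps_unitPl f g : g * f = 1 -> fps_unit f.
Proof.
move=> /fpsP/(_ 0%N); rewrite coef_fpsM big_ord1 subnn coef_fps1 mulrC => fg.
by apply/unitrPr; exists (g 0%N).
Qed.

Fact fps_invr_out : {in [predC fps_unit], fps_inv =1 id}.
Proof. by move=> f /negPf; rewrite /fps_inv => ->. Qed.

HB.instance Definition _ := GRing.ComNzRing_hasMulInverse.Build (fps R)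
  fps_mulVx fps_unitPl fps_invr_out.

Lemma fps_unitE f : (f \is a GRing.unit) = (f 0%N \is a GRing.unit).
Proof. by []. Qed.

(* The following three series are meaningful when every n`! is a unit of R.   *)

(* e^(a t) *)
Definition fps_exp (a : R) : fps R := FPS (fun n => a ^+ n / n`!%:R).

(* (1 + t)^a, the binomial series: a need not be an integer. *)
Definition fps_pow1X (a : R) : fps R :=
  FPS (fun n => (\prod_(i < n) (a - i%:R)) / n`!%:R).

(* \sum_n a_n t^n / n! *)
Definition egf (a : nat -> R) : fps R := FPS (fun n => a n / n`!%:R).

(* The sequence a such that f = egf a. *)
Definition egf_coef (f : fps R) (n : nat) : R := n`!%:R * f n.

Lemma egf_coefK f : (forall n, (n`!%:R : R) \is a GRing.unit) ->
  egf (egf_coef f) = f.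
Proof. by move=> uR; apply/fpsP => n /=; rewrite mulrAC divrr ?mul1r. Qed.

Lemma fps_pow1X_nat (m : nat) : (forall n, (n`!%:R : R) \is a GRing.unit) ->
  fps_pow1X m%:R = (1 + fpsX R) ^+ m.
Proof.
move=> uR; have Ebin k n : fps_pow1X k%:R n = 'C(k, n)%:R.
  rewrite /= -[RHS](mulrK (uR n)) -natrM bin_ffact; congr (_ / _).
  elim: n => [|n IHn]; first by rewrite big_ord0.
  rewrite big_ord_recr /= IHn ffactnSr natrM.
  have [le_nk|lt_kn] := leqP n k; first by rewrite natrB.
  by rewrite ffact_small // !mul0r.
elim: m => [|m IHm].
  by apply/fpsP => n; rewrite Ebin bin0n expr0 coef_fps1.
rewrite exprS -IHm; apply/fpsP => n; rewrite Ebin mulrDl mul1r coef_fpsD Ebin.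
rewrite coef_fpsM; case: n => [|n].
  by rewrite big_ord1 /= mul0r addr0 !bin0.
rewrite binS natrD big_ord_recl mul0r add0r big_ord_recl [(fpsX R) _]/= mul1r.
rewrite subSS subn0 Ebin big1 ?addr0 // => i _.
by rewrite [(fpsX R) _]/= mul0r.
Qed.

End FpsUnitRing.

(* The variable x is the indeterminate 'X of {poly rat}, so that the          *)
(* generating functions of E*_n(x) and c_n(x) are series over {poly rat}.     *)

Definition type2_Euler : nat -> {poly rat} :=
  egf_coef (2%:R / (fps_exp 1 + fps_exp (- 1)) * fps_exp 'X).

Definition type2_Changhee : nat -> {poly rat} :=
  let u := 1 + fpsX {poly rat} in
  egf_coef (2%:R / (u + u^-1) * fps_pow1X 'X).

Definition stirling2 (n l : nat) : rat :=
  egf_coef ((fps_exp 1 - 1) ^+ l / l`!%:R) n.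

Lemma rat_fact_unit n : (n`!%:R : rat) \is a GRing.unit.
Proof. by rewrite unitfE Num.Theory.pnatr_eq0 -lt0n fact_gt0. Qed.

Lemma poly_rat_fact_unit n : (n`!%:R : {poly rat}) \is a GRing.unit.
Proof. by rewrite -polyC_natr rmorph_unit // rat_fact_unit. Qed.

Lemma poly_rat_unit2 : (2%:R : {poly rat}) \is a GRing.unit.
Proof. exact: (poly_rat_fact_unit 2). Qed.

(* The divisions above are genuine, i.e. the defining identities hold. *)

Lemma type2_Euler_egf :
  egf type2_Euler * (fps_exp 1 + fps_exp (- 1)) = 2%:R * fps_exp 'X.
Proof.
rewrite egf_coefK; last exact: poly_rat_fact_unit.
rewrite mulrAC divrK // fps_unitE coef_fpsD /= !expr0 divr1 -mulr2n.
exact: poly_rat_unit2.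
Qed.

Lemma type2_Changhee_egf (u := 1 + fpsX {poly rat}) :
  u * u^-1 = 1 /\
  egf type2_Changhee * (u + u^-1) = 2%:R * fps_pow1X 'X.
Proof.
have uu : u \is a GRing.unit by rewrite fps_unitE coef_fpsD /= addr0 unitr1.
have uuV := mulrV uu; split=> //.
rewrite egf_coefK; last exact: poly_rat_fact_unit.
rewrite mulrAC divrK // fps_unitE coef_fpsD.
move/fpsP/(_ 0%N): uuV; rewrite coef_fpsM big_ord1 subnn coef_fps1.
rewrite [u 0%N](_ : _ = 1) ?mul1r; last by rewrite /u coef_fpsD /= addr0.
by move=> ->; exact: poly_rat_unit2.
Qed.

Lemma stirling2_egf (l : nat) :
  l`!%:R * egf (stirling2 ^~ l) = (fps_exp 1 - 1) ^+ l.
Proof.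
rewrite (egf_coefK _ rat_fact_unit) mulrC divrK // fps_unitE coef_fps_nat muln1.
exact: rat_fact_unit.
Qed.

(* Main.v *)
Require Import Defs.
From HB Require Import structures.
From mathcomp Require Import all_boot all_order all_algebra.
Import GRing.Theory.
Local Open Scope ring_scope.

(** The substitution t |-> e^t - 1 is a ring morphism of formal power series.
    It sends 1 + t to e^t and (1 + t)^x to e^(xt), since both sides of the
    latter solve h' = x h with h(0) = 1; hence it sends the generating function
    of the c_l(x) to that of the E*_n(x).  Expanding the powers of e^t - 1 by
    Stirling numbers and comparing coefficients gives the identity. *)

Section Composition.
Context {R : comNzRingType}.
Implicit Types f g w : fps R.

(** Since [w] is divisible by t, [w ^+ l] is divisible by t^l. *)
Lemma fps_expr_small w (wz : w 0%N = 0) l n : (n < l)%N -> (w ^+ l) n = 0.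
Proof.
elim: l n => // l IHl n lt_nl; rewrite exprS coef_fpsM big1 // => -[[|i] lt_i] _ /=.
  by rewrite wz mul0r.
rewrite IHl ?mulr0 //; case: n lt_nl lt_i => // n lt_nl lt_i.
by rewrite subSS (leq_ltn_trans (leq_subr _ _)).
Qed.

(* The sum defining each coefficient is truncated, which is legitimate only
   because w has no constant term. *)
Definition fps_comp w of w 0%N = 0 := fun f : fps R =>
  FPS (fun n => \sum_(l < n.+1) f l * (w ^+ l) n).

(** The extra terms vanish, so one common range of summation can serve coefficients of different
    degrees. *)
Lemma coef_fps_comp w (wz : w 0%N = 0) f N n : (n < N)%N ->
  fps_comp w wz f n = \sum_(l < N) f l * (w ^+ l) n.
Proof.
move=> lt_nN; rewrite /= (big_ord_widen N (fun l => f l * (w ^+ l) n)) //.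
rewrite big_mkcond; apply: eq_bigr => l _; case: ltnP => // lt_nl.
by rewrite fps_expr_small ?mulr0.
Qed.

Lemma fps_compB w wz : {morph fps_comp w wz : f g / f - g}.
Proof.
move=> f g; apply/fpsP => n; rewrite coef_fpsD coef_fpsN /= -sumrB.
by apply: eq_bigr => l _; rewrite mulrBl.
Qed.

Lemma fps_compM w wz : {morph fps_comp w wz : f g / f * g}.
Proof.
move=> f g; apply/fpsP => n; rewrite [RHS]coef_fpsM.
(* Both sides are compared with the full square of indices; the Cauchy product only reaches
   [a + b <= n], but [w ^+ (a + b)] has no t^n term beyond that. *)
transitivity (\sum_(a < n.+1) \sum_(b < n.+1) f a * g b * (w ^+ (a + b)) n).
  rewrite (@coef_fps_comp _ _ _ n.+1) //.
  transitivity (\sum_(l < n.+1) \sum_(a < n.+1 | (a <= l)%N)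
      f a * g (l - a)%N * (w ^+ l) n).
    apply: eq_bigr => l _; rewrite coef_fpsM mulr_suml.
    by rewrite (big_ord_widen n.+1 (fun i => f i * g (l - i)%N * (w ^+ l) n)).
  rewrite (exchange_big_dep predT) //=; apply: eq_bigr => a _.
  have le_an : (a <= n)%N by rewrite -ltnS.
  transitivity (\sum_(a <= l < n.+1) f a * g (l - a)%N * (w ^+ l) n).
    rewrite big_geq_mkord; exact: eq_bigl.
  rewrite -{1}[val a]add0n big_addn big_mkord.
  rewrite (big_ord_widen n.+1 (fun b => f a * g (b + a - a)%N * (w ^+ (b + a)) n))
    ?leq_subr //.
  rewrite big_mkcond; apply: eq_bigr => b _; rewrite addnK addnC.
  by case: ltnP => // le_nb; rewrite [in RHS]fps_expr_small ?mulr0 -?leq_subLR.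
transitivity (\sum_(j < n.+1) \sum_(a < n.+1) \sum_(b < n.+1)
   f a * g b * ((w ^+ a) j * (w ^+ b) (n - j)%N)).
  rewrite [RHS]exchange_big; apply: eq_bigr => a _.
  rewrite [RHS]exchange_big; apply: eq_bigr => b _.
  by rewrite exprD coef_fpsM mulr_sumr.
apply: eq_bigr => j _; rewrite !(@coef_fps_comp _ _ _ n.+1) ?ltnS ?leq_subr ?leq_ord //.
rewrite mulr_suml; apply: eq_bigr => a _; rewrite mulr_sumr.
by apply: eq_bigr => b _; rewrite mulrACA.
Qed.

Lemma fps_comp1 w wz : fps_comp w wz 1 = 1.
Proof.
apply/fpsP => n /=; rewrite big_ord_recl mul1r expr0 big1 ?addr0 // => i _.
by rewrite mul0r.
Qed.

HB.instance Definition _ w wz :=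
  GRing.isZmodMorphism.Build (fps R) (fps R) (fps_comp w wz) (fps_compB w wz).
HB.instance Definition _ w wz :=
  GRing.isMonoidMorphism.Build (fps R) (fps R) (fps_comp w wz)
    (fps_comp1 w wz, fps_compM w wz).

Lemma fps_compX w wz : fps_comp w wz (fpsX R) = w.
Proof.
(* The bound [n.+2] keeps the index 1 in range even when [n] is 0. *)
apply/fpsP => n; rewrite (@coef_fps_comp _ _ _ n.+2) // !big_ord_recl /=.
by rewrite mul0r add0r mul1r expr1 big1 ?addr0 // => i _; rewrite mul0r.
Qed.

Definition fps_deriv f : fps R := FPS (fun n => f n.+1 *+ n.+1).

Lemma fps_derivM f g : fps_deriv (f * g) = fps_deriv f * g + f * fps_deriv g.
Proof.
apply/fpsP => n; rewrite coef_fpsD [LHS]/= !coef_fpsM -sumrMnl.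
(* The factor n+1 is split as i + (n+1-i), one summand for each derivative. *)
transitivity (\sum_(i < n.+2) (f i *+ i * g (n.+1 - i)%N +
    f i * (g (n.+1 - i)%N *+ (n.+1 - i)))).
  by apply: eq_bigr => i _; rewrite mulrnAl mulrnAr -mulrnDr subnKC ?leq_ord.
rewrite big_split /=; congr (_ + _).
  rewrite big_ord_recl mulr0n mul0r add0r; apply: eq_bigr => i _.
  by rewrite subSS.
rewrite big_ord_recr /= subnn mulr0n mulr0 addr0; apply: eq_bigr => i _.
by rewrite subSn // -ltnS.
Qed.

Lemma fps_derivX f l : fps_deriv (f ^+ l.+1) = f ^+ l * fps_deriv f *+ l.+1.
Proof.
elim: l => [|l IHl]; first by rewrite expr1 expr0 mul1r.
rewrite exprS fps_derivM IHl mulrnAr mulrA -exprS mulrC.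
by rewrite -mulrS.
Qed.

(** Chain rule, obtained termwise from the power rule; the term of index 0 is constant and drops
    out. *)
Lemma fps_deriv_comp w wz f :
  fps_deriv (fps_comp w wz f) = fps_comp w wz (fps_deriv f) * fps_deriv w.
Proof.
apply/fpsP => n; rewrite [LHS]/= big_ord_recl expr0 coef_fps1 mulr0 add0r -sumrMnl.
transitivity (\sum_(j < n.+1) \sum_(l < n.+1)
    fps_deriv f l * ((w ^+ l) j * fps_deriv w (n - j)%N)).
  rewrite [RHS]exchange_big; apply: eq_bigr => l _.
  rewrite -mulr_sumr -coef_fpsM -mulrnAr [_ *+ n.+1](_ : _ = fps_deriv (w ^+ l.+1) n) //.
  by rewrite fps_derivX coef_fpsMn mulrnAr /= mulrnAl.
rewrite coef_fpsM; apply: eq_bigr => j _.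
rewrite (@coef_fps_comp _ _ _ n.+1) // mulr_suml.
by apply: eq_bigr => l _; rewrite mulrA.
Qed.

End Composition.

Section Exponential.
Context {R : comUnitRingType} (uR : forall n, (n`!%:R : R) \is a GRing.unit).
Implicit Types (a b : R) (f : fps R).
Local Notation exp := (@fps_exp R).

Lemma unit_natS n : (n.+1%:R : R) \is a GRing.unit.
Proof. by have := uR n.+1; rewrite factS natrM unitrM => /andP[]. Qed.

Lemma div_factS (c : R) n : c / (n.+1)`!%:R *+ n.+1 = c / n`!%:R.
Proof.
rewrite factS natrM invrM ?unit_natS // -mulr_natr mulrA mulrVK //.
exact: unit_natS.
Qed.

Lemma fps_deriv_exp a : fps_deriv (exp a) = FPS (fun n => a * exp a n).
Proof. by apply/fpsP => n /=; rewrite div_factS exprS mulrA. Qed.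

(** The equation reads (n+1) f_(n+1) = a f_n, and n+1 is invertible, so f_0 determines every
    coefficient. *)
Lemma fps_exp_unique a f : f 0%N = 1 ->
  fps_deriv f = FPS (fun n => a * f n) -> f = exp a.
Proof.
move=> f0 /fpsP df; apply/fpsP; elim=> [|n IHn]; first by rewrite f0 /= divr1.
apply: (mulrI (unit_natS n)); rewrite !mulr_natl.
have /= -> := df n; rewrite IHn.
by have /fpsP/(_ n)/= -> := fps_deriv_exp a.
Qed.

Lemma fps_expD a b : exp a * exp b = exp (a + b).
Proof.
apply: fps_exp_unique; first by rewrite coef_fpsM big_ord1 /= divr1 mulr1.
rewrite fps_derivM !fps_deriv_exp; apply/fpsP => n.
rewrite coef_fpsD !coef_fpsM /= mulrDl !mulr_sumr; congr (_ + _).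
  by apply: eq_bigr => i _; rewrite -mulrA.
by apply: eq_bigr => i _; rewrite mulrCA.
Qed.

Lemma fps_exp0 : exp 0 = 1.
Proof.
by apply/fpsP => -[|n] /=; rewrite ?divr1 // exprS !mul0r.
Qed.

Lemma fps_expN a : exp (- a) = (exp a)^-1.
Proof.
have u : exp a \is a GRing.unit by rewrite fps_unitE /= divr1 unitr1.
by apply: (mulrI u); rewrite divrr // fps_expD subrr fps_exp0.
Qed.

Lemma expm1_0 : (exp 1 - 1) 0%N = 0.
Proof. by rewrite coef_fpsD coef_fpsN /= divr1 subrr. Qed.

Local Notation comp_expm1 := (fps_comp (exp 1 - 1) expm1_0).

Lemma comp_expm1_1X : comp_expm1 (1 + fpsX R) = exp 1.
Proof. by rewrite rmorphD rmorph1 /= fps_compX addrC subrK. Qed.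

(** Writing e^t as the image of 1 + t lets the chain rule factor be absorbed into the
    composition. *)
Lemma deriv_expm1 : fps_deriv (exp 1 - 1) = comp_expm1 (1 + fpsX R).
Proof.
by rewrite comp_expm1_1X; apply/fpsP => n; rewrite /= subr0 div_factS !expr1n.
Qed.

(** With b_n the coefficients of (1 + t)^a, this is (n+1) b_(n+1) + n b_n = (a - n) b_n + n b_n = a
    b_n. *)
Lemma fps_deriv_pow1X a :
  fps_deriv (fps_pow1X a) * (1 + fpsX R) = FPS (fun n => a * fps_pow1X a n).
Proof.
apply/fpsP => n; rewrite mulrDr mulr1 coef_fpsD mulrC [X in X + _]/= div_factS.
rewrite big_ord_recr /=; case: n => [|n].
  by rewrite big_ord1 !big_ord0 mul0r addr0 subr0 !mul1r.
rewrite [X in _ + X]big_ord_recl mul0r add0r [X in _ + X]big_ord_recl /= mul1r.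
rewrite subSS subn0 [X in _ + (_ + X)]big1 ?addr0; last by move=> i _; rewrite mul0r.
by rewrite mulrAC -[X in _ + X]mulr_natr -mulrDr subrK mulrC.
Qed.

Lemma comp_expm1_pow1X a : comp_expm1 (fps_pow1X a) = exp a.
Proof.
apply: fps_exp_unique => [|].
  by rewrite /= big_ord1 big_ord0 divr1 mul1r expr0.
(* By multiplicativity the derivative is the image of (1 + t) times the derivative of (1 + t)^a,
   hence of a (1 + t)^a. *)
rewrite fps_deriv_comp deriv_expm1 -fps_compM fps_deriv_pow1X.
by apply/fpsP => n /=; rewrite mulr_sumr; apply: eq_bigr => l _; rewrite [RHS]mulrA.
Qed.

End Exponential.

(** Bridges the Stirling numbers, defined over [rat], and the generating functions, whose
    coefficients lie in [{poly rat}]. *)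
Lemma coef_expm1X_poly l n :
  ((fps_exp (1 : {poly rat}) - 1) ^+ l) n = (((fps_exp (1 : rat) - 1) ^+ l) n)%:P.
Proof.
elim: l n => [|l IHl] n; first by rewrite !expr0 !coef_fps1 polyC_natr.
rewrite !exprS !coef_fpsM rmorph_sum; apply: eq_bigr => i _.
rewrite IHl rmorphM; congr (_ * _); rewrite !coef_fpsD !coef_fpsN /= !expr1n.
by rewrite rmorphB rmorphM rmorphV ?rat_fact_unit // !rmorph_nat.
Qed.

Lemma stirling2E n l :
  stirling2 n l * l`!%:R = n`!%:R * ((fps_exp 1 - 1) ^+ l) n.
Proof.
have /fpsP/(_ n) <- := stirling2_egf l.
rewrite [l`!%:R * egf _]mulr_natl coef_fpsMn [RHS]mulrnAr [LHS]mulr_natr.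
by congr (_ *+ _); rewrite [RHS]mulrC [RHS]divrK ?rat_fact_unit.
Qed.

Theorem theorem2 (n : nat) :
  type2_Euler n = \sum_(0 <= l < n.+1) stirling2 n l *: type2_Changhee l.
Proof.
have uP := poly_rat_fact_unit.
have u1X : 1 + fpsX {poly rat} \is a GRing.unit.
  by rewrite fps_unitE coef_fpsD /= addr0 unitr1.
(* The constant term is 2. Invertibility is needed for the morphism to commute with the quotient. *)
have uD : 1 + fpsX {poly rat} + (1 + fpsX {poly rat})^-1 \is a GRing.unit.
  rewrite fps_unitE coef_fpsD; have /fpsP/(_ 0%N) := mulrV u1X.
  by rewrite coef_fpsM big_ord1 coef_fpsD addr0 mul1r => ->; apply: poly_rat_unit2.
(* Every ingredient of the Euler series becomes an image under composition, so the whole series is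
   the image of the Changhee series. *)
rewrite /type2_Euler fps_expN // -comp_expm1_1X -(comp_expm1_pow1X uP 'X).
rewrite -rmorphV // -rmorphD -(rmorph_nat (fps_comp _ expm1_0)).
rewrite -rmorph_div // -rmorphM big_mkord /egf_coef (coef_fps_comp _ _ _ n.+1) //.
rewrite mulr_sumr; apply: eq_bigr => l _; rewrite coef_expm1X_poly -mul_polyC.
rewrite [RHS]mulrA -[l`!%:R](rmorph_nat polyC) -rmorphM stirling2E rmorphM.
by rewrite rmorph_nat -[RHS]mulrA; congr (_ * _); apply: mulrC.
Qed.
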